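(* Any proof labeling scheme for $\textsc{Circle-Recognition}$, and (for every fixed $k$) any proof labeling scheme for $k\textsc{-Polygon-Circle-Recognition}$, must use certificates of size $\Omega(\log n)$ bits on $n$-node networks.
   Context: A circle graph is the intersection graph of a family of chords of a circle; a $k$-polygon-circle graph is the intersection graph of a family of convex polygons with $k$ vertices, all vertices on a common circle. $\textsc{Circle-Recognition}$ (resp. $k\textsc{-Polygon-Circle-Recognition}$) is the set of configurations $\langle G,\mathrm{id}\rangle$ with $G$ a circle (resp. $k$-polygon-circle) graph. Distributed setting: $G$ is a simple connected $n$-node graph, nodes have unique identifiers in $\{1,\dots,\mathrm{poly}(n)\}$. A proof labeling scheme: an untrusted prover assigns each node a certificate; in one deterministic round each node sees its own id and certificate and those of its neighbors, and accepts or rejects; on yes-instances some assignment makes all nodes accept, on no-instances every assignment makes some node reject. Its size is the maximum certificate length. *)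

(* Defs.v *)
From HB Require Import structures.
From mathcomp Require Import all_boot all_order all_algebra.
From mathcomp Require Import Rstruct.

Set Implicit Arguments.
Unset Strict Implicit.
Unset Printing Implicit Defensive.

Import Order.TTheory GRing.Theory Num.Theory.

Definition point := (Rdefinitions.R * Rdefinitions.R)%type.
Notation R := Rdefinitions.R.

Local Open Scope ring_scope.

Definition on_circle (p : point) : Prop := p.1 ^+ 2 + p.2 ^+ 2 = 1.

Definition in_hull (m : nat) (P : 'I_m -> point) (x : point) : Prop :=
  exists w : 'I_m -> R,
    [/\ forall i, 0 <= w i,
        \sum_(i < m) w i = 1,
        x.1 = \sum_(i < m) w i * (P i).1 &
        x.2 = \sum_(i < m) w i * (P i).2].

(* A convex polygon with k vertices, all on the (unit) circle:
   k pairwise distinct points of the circle (such points are automatically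
   in convex position); the polygon is their convex hull. *)
Definition inscribed_polygon (k : nat) (P : 'I_k -> point) : Prop :=
  injective P /\ forall i, on_circle (P i).

Definition chord (P : 'I_2 -> point) : Prop := inscribed_polygon P.

Local Close Scope ring_scope.

Definition simple_graph (n : nat) (e : rel 'I_n) : Prop :=
  irreflexive e /\ symmetric e.

Definition connected_graph (n : nat) (e : rel 'I_n) : Prop :=
  forall u v : 'I_n, connect e u v.

Definition intersection_graph_of (n m : nat) (e : rel 'I_n)
    (F : 'I_n -> 'I_m -> point) : Prop :=
  forall u v : 'I_n, u != v ->
    (e u v <-> exists x : point, in_hull (F u) x /\ in_hull (F v) x).

Definition circle_graph (n : nat) (e : rel 'I_n) : Prop :=
  exists F : 'I_n -> 'I_2 -> point,
    (forall v, chord (F v)) /\ intersection_graph_of e F.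

Definition polygon_circle_graph (k : nat) (n : nat) (e : rel 'I_n) : Prop :=
  exists F : 'I_n -> 'I_k -> point,
    (forall v, inscribed_polygon (F v)) /\ intersection_graph_of e F.

Definition network (c n : nat) (e : rel 'I_n) (id : 'I_n -> nat) : Prop :=
  [/\ simple_graph e, connected_graph e, injective id &
      forall v, 1 <= id v <= n ^ c].

Definition certificate := seq bool.

(* What node v sees in one round: its own id and certificate, and the ids
   and certificates of its neighbours (listed in increasing order of id,
   so that the view carries no information beyond these data). *)
Definition neighbour_view (n : nat) (e : rel 'I_n) (id : 'I_n -> nat)
    (cert : 'I_n -> certificate) (v : 'I_n) : seq (nat * certificate) :=
  [seq (id u, cert u) | u <- sort (fun a b => id a <= id b) (enum (e v))].

Definition verifier := nat -> certificate -> seq (nat * certificate) -> bool.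

Definition accepts (V : verifier) (n : nat) (e : rel 'I_n) (id : 'I_n -> nat)
    (cert : 'I_n -> certificate) (v : 'I_n) : bool :=
  V (id v) (cert v) (neighbour_view e id cert v).

Definition is_PLS (c : nat) (P : forall n, rel 'I_n -> Prop)
    (V : verifier) (s : nat -> nat) : Prop :=
  (forall n e id, network c e id -> P n e ->
     exists cert : 'I_n -> certificate,
       (forall v, size (cert v) <= s n) /\ (forall v, accepts V e id cert v))
  /\
  (forall n e id, network c e id -> ~ P n e ->
     forall cert : 'I_n -> certificate, exists v, ~~ accepts V e id cert v).

Definition omega_log (s : nat -> nat) : Prop :=
  exists C N : nat, 0 < C /\ forall n, N <= n -> trunc_log 2 n <= C * s n.

(* Main.v *)
From HB Require Import structures.
Require Import Defs.
From mathcomp Require Import all_boot all_order all_algebra all_fingroup.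
From mathcomp Require Import Rstruct ring lra zify.

(**
Take a vertex adjacent to everything and m disjoint paths of q vertices, and for a permutation t of
'I_m join the end of path i to the beginning of path t i, except when t i = 0. If t is an m-cycle,
the paths line up into one long path and the graph is a fan, which is a circle graph. Otherwise some
cycle of t avoids 0 and the graph contains a wheel with at least q = 2k+4 rim vertices, which is not a
k-polygon-circle graph: about half of the rim polygons each need a hub vertex of their own.

Each vertex sees at most one value of t. Hence, if F is a set of m-cycles whose graphs receive the same
certificates, every permutation t such that each pair (i, t i) occurs in a member of F is accepted,
so by soundness it is an m-cycle. All these t have the same sign, so their number is the absolute
value of the determinant of a 0/1 matrix, at most m^(m/2) by Hadamard's inequality. As there are
(m-1)! cycles, at least (m-1)!/m^(m/2) certificate assignments are needed, that is, log m bits per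
vertex up to a constant. The identifiers never change and are 1, ..., n, so this covers c = 1.
*)

Set Implicit Arguments.
Unset Strict Implicit.
Unset Printing Implicit Defensive.

Import Order.TTheory GRing.Theory Num.Theory.

Local Open Scope ring_scope.

(** * Hadamard's inequality and permutations of constant sign *)

Lemma gram_diag_ge0 (F : realFieldType) n p (A : 'M[F]_(n, p)) i :
  0 <= (A *m A^T) i i.
Proof.
by rewrite !mxE sumr_ge0 // => j _; rewrite !mxE -expr2 sqr_ge0.
Qed.

Lemma gram_row_eq0 (F : realFieldType) p (r : 'rV[F]_p) :
  (r *m r^T) 0 0 = 0 -> r = 0.
Proof.
rewrite mxE => /eqP; rewrite psumr_eq0; last first.
  by move=> j _; rewrite !mxE -expr2 sqr_ge0.
move=> /allP r0; apply/rowP => j; rewrite mxE.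
by have := r0 j (mem_index_enum j); rewrite mxE -expr2 sqrf_eq0 => /eqP.
Qed.

(** One Gram-Schmidt step per row: subtracting from the other rows their projections on the first
    preserves the determinant and can only decrease the diagonal of the Gram matrix. *)
Lemma gram_det_bounds (F : realFieldType) n p (A : 'M[F]_(n, p)) :
  0 <= \det (A *m A^T) <= \prod_i (A *m A^T) i i.
Proof.
elim: n A => [|n IHn] A; first by rewrite det_mx00 big_ord0 ler01 lexx.
rewrite -[n.+1]/(1 + n)%N in A *.
pose r := usubmx A; pose B := dsubmx A; pose a := (r *m r^T) 0 0.
have defA : A = col_mx r B by rewrite vsubmxK.
have rr : r *m r^T = a%:M by rewrite [LHS]mx11_scalar.
have gramA : A *m A^T = block_mx a%:M (r *m B^T) (B *m r^T) (B *m B^T).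
  by rewrite defA tr_col_mx mul_col_row rr.
have prodA : \prod_i (A *m A^T) i i = a * \prod_i (B *m B^T) i i.
  rewrite big_split_ord /= big_ord1; congr (_ * _).
    by rewrite gramA block_mxEul mxE eqxx.
  by apply: eq_bigr => i _; rewrite gramA block_mxEdr.
have [a0|a_neq0] := eqVneq a 0.
  have r0 : r = 0 by exact: gram_row_eq0.
  by rewrite prodA gramA a0 r0 mul0mx det_lblock det_scalar expr1 !mul0r lexx.
(* [c] holds the projection coefficients on [r], so the rows of [B'] are orthogonal to [r]. *)
pose c := a^-1 *: (B *m r^T); pose B' := B - c *m r.
have cE : B *m r^T = a *: c by rewrite scalerA divff // scale1r.
have cE' : r *m B^T = a *: c^T by rewrite -linearZ /= -cE trmx_mul trmxK.
have B'r : B' *m r^T = 0.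
  by rewrite mulmxBl -mulmxA rr mul_mx_scalar cE subrr.
have B'B' : B' *m B'^T = B *m B^T - a *: (c *m c^T).
  rewrite [B'^T]linearB /= trmx_mul mulmxBr mulmxA B'r mul0mx subr0.
  by rewrite mulmxBl -mulmxA cE' scalemxAr.
have detA : \det (A *m A^T) = a * \det (B' *m B'^T).
  pose U := block_mx (1%:M : 'M[F]_1) 0 (- c) (1%:M : 'M_n).
  have detU : \det U = 1 by rewrite det_lblock !det1 mulr1.
  have UA : U *m A = col_mx r B'.
    by rewrite defA mul_block_col !mul1mx mul0mx addr0 mulNmx addrC.
  have -> : \det (A *m A^T) = \det (U *m A *m (U *m A)^T).
    by rewrite trmx_mul mulmxA -(mulmxA U) !det_mulmx det_tr detU mul1r mulr1.
  by rewrite UA tr_col_mx mul_col_row rr B'r det_ublock det_scalar expr1.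
have a_ge0 : 0 <= a by exact: gram_diag_ge0.
have /andP[det_ge0 det_le] := IHn B'.
rewrite detA prodA mulr_ge0 //=; apply: ler_wpM2l => //.
apply: le_trans det_le _; apply: ler_prod => i _; rewrite gram_diag_ge0 /=.
have -> : (B' *m B'^T) i i = (B *m B^T) i i - a * (c *m c^T) i i.
  by rewrite B'B' !mxE.
by rewrite lerBlDr lerDl mulr_ge0 // gram_diag_ge0.
Qed.

(** The nonzero terms in the Leibniz formula for the 0/1 matrix of [B] all have one sign, so the
    count is the determinant up to sign. Rows have squared norm at most [m], and Hadamard's
    inequality applies. *)
Lemma card_same_sign_matchings m (B : rel 'I_m) (b : bool) :
  (forall t : 'S_m, (forall i, B i (t i)) -> odd_perm t = b) ->
  (#|[set t : 'S_m | [forall i, B i (t i)]]| ^ 2 <= m ^ m)%N.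
Proof.
move=> signB; set F := [set t | _].
pose A : 'M[rat]_m := \matrix_(i, j) (B i j)%:R.
have prodA (t : 'S_m) : \prod_i A i (t i) = (t \in F)%:R.
  rewrite inE; have [/forallP Bt|] := boolP [forall i, B i (t i)].
    by rewrite big1 // => i _; rewrite mxE Bt.
  rewrite negb_forall => /existsP[i /negPf Bi].
  by rewrite (bigD1 i) //= mxE Bi mul0r.
have detA : \det A = (-1) ^+ b * #|F|%:R.
  rewrite /determinant -sum1_card natr_sum mulr_sumr big_mkcond /=.
  rewrite [RHS]big_mkcond /=; apply: eq_bigr => t _; rewrite prodA.
  case: ifP => [tF|]; last by rewrite mulr0.
  by rewrite (signB t) // => i; move: tF; rewrite inE => /forallP.
have := gram_det_bounds A => /andP[_].
rewrite det_mulmx det_tr -expr2 detA exprMn sqrr_sign mul1r => le_det.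
rewrite -(ler_nat rat) !natrX; apply: le_trans le_det _.
rewrite -[X in _ ^+ X]card_ord -prodr_const; apply: ler_prod => i _.
rewrite gram_diag_ge0 /= mxE.
apply: (@le_trans _ _ (\sum_(j < m) 1)).
  by apply: ler_sum => j _; rewrite !mxE; case: (B i j); rewrite ?mulr1 ?mulr0.
by rewrite sumr_const card_ord.
Qed.

(** * Inscribed polygons in the rational parametrization of the circle *)

Definition circ (t : R) : point := ((1 - t ^+ 2) / (1 + t ^+ 2), t *+ 2 / (1 + t ^+ 2)).

(** Twice the signed area of the triangle [p q x]; the sign tells on which side of the line [p q]
    the point [x] lies. *)
Definition orient (p q x : point) : R :=
  (q.1 - p.1) * (x.2 - p.2) - (q.2 - p.2) * (x.1 - p.1).

Lemma one_sqr_neq0 (t : R) : 1 + t ^+ 2 != 0.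
Proof. by rewrite gt_eqF // ltr_wpDr ?sqr_ge0. Qed.

Lemma on_circle_circ t : on_circle (circ t).
Proof. by rewrite /on_circle /=; field; exact: one_sqr_neq0. Qed.

Lemma circ_inj : injective circ.
Proof.
move=> s t [e1 e2]; pose u := 1 + s ^+ 2; pose v := 1 + t ^+ 2.
have u0 : u != 0 by exact: one_sqr_neq0.
have v0 : v != 0 by exact: one_sqr_neq0.
have uv : u = v.
  have {}e1 : 2 / u = 2 / v.
    have -> : 2 / u = (1 - s ^+ 2) / u + 1 by rewrite /u; field; exact: one_sqr_neq0.
    by rewrite e1 /v; field; exact: one_sqr_neq0.
  by apply/invr_inj/(mulfI _ e1); rewrite pnatr_eq0.
move: e2; rewrite -/u -/v uv => /(mulIf (invr_neq0 v0)).
by rewrite -(mulr_natr s) -(mulr_natr t) => /mulIf; apply; rewrite pnatr_eq0.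
Qed.

(** A Vandermonde determinant up to a positive factor: sides of chords are decided by the order of
    the parameters. *)
Lemma orient_circ a b c : orient (circ a) (circ b) (circ c) =
  4 * ((b - a) * (c - a) * (c - b)) / ((1 + a ^+ 2) * (1 + b ^+ 2) * (1 + c ^+ 2)).
Proof. by rewrite /orient /=; field; rewrite !one_sqr_neq0. Qed.

Lemma sgr_orient_circ a b c :
  Num.sg (orient (circ a) (circ b) (circ c)) = Num.sg ((b - a) * (c - a) * (c - b)).
Proof.
have pos (t : R) : 0 < 1 + t ^+ 2 by rewrite ltr_wpDr ?sqr_ge0.
rewrite orient_circ sgrM [X in _ * X]gtr0_sg ?mulr1; last first.
  by rewrite invr_gt0 !mulr_gt0.
by rewrite sgrM gtr0_sg ?mul1r.
Qed.

Lemma orient_circ_gt0 a b c : a < b -> b < c -> 0 < orient (circ a) (circ b) (circ c).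
Proof.
move=> ab bc; rewrite -sgr_gt0 sgr_orient_circ sgr_gt0.
by rewrite !mulr_gt0 ?subr_gt0 // (lt_trans ab).
Qed.

Lemma orient_hull m (P : 'I_m -> point) (w : 'I_m -> R) (x p q : point) :
  \sum_(i < m) w i = 1 -> x.1 = \sum_(i < m) w i * (P i).1 ->
  x.2 = \sum_(i < m) w i * (P i).2 ->
  orient p q x = \sum_(i < m) w i * orient p q (P i).
Proof.
move=> w1 x1 x2; rewrite /orient x1 x2.
rewrite (_ : \sum_(i < m) w i * (P i).2 - p.2 =
             \sum_(i < m) w i * ((P i).2 - p.2)); last first.
  by under [RHS]eq_bigr do rewrite mulrBr; rewrite sumrB -mulr_suml w1 mul1r.
rewrite (_ : \sum_(i < m) w i * (P i).1 - p.1 =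
             \sum_(i < m) w i * ((P i).1 - p.1)); last first.
  by under [RHS]eq_bigr do rewrite mulrBr; rewrite sumrB -mulr_suml w1 mul1r.
rewrite !mulr_sumr -sumrB; apply: eq_bigr => i _; ring.
Qed.

(** The line through [circ a] and [circ b] separates: [orient] is nonpositive on the first hull,
    positive on the second. *)
Lemma hull_separated m m' (T : 'I_m -> R) (S : 'I_m' -> R) (a b : R) (x : point) :
  a < b -> (forall i, a <= T i <= b) -> (forall j, (S j < a) || (b < S j)) ->
  in_hull (circ \o T) x -> in_hull (circ \o S) x -> False.
Proof.
move=> ab Tab Sab [w [w0 w1 x1 x2]] [v [v0 v1 y1 y2]].
have le0 : orient (circ a) (circ b) x <= 0.
  rewrite (orient_hull _ _ w1 x1 x2); apply: sumr_le0 => i _ /=.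
  apply: mulr_ge0_le0; rewrite // -sgr_le0 sgr_orient_circ sgr_le0.
  have /andP[aT Tb] := Tab i.
  by rewrite mulr_ge0_le0 ?mulr_ge0 ?subr_ge0 ?subr_le0 ?(ltW ab).
have gt0 j : 0 < orient (circ a) (circ b) (circ (S j)).
  rewrite -sgr_gt0 sgr_orient_circ sgr_gt0.
  have := Sab j; rewrite -mulrA pmulr_rgt0 ?subr_gt0 //.
  case/orP => [Sa|bS].
    by rewrite nmulr_rgt0 subr_lt0 // (lt_trans Sa).
  by rewrite mulr_gt0 ?subr_gt0 // (lt_trans ab).
have ge0 j : 0 <= v j * orient (circ a) (circ b) ((circ \o S) j).
  by apply: mulr_ge0 => //; exact/ltW/gt0.
have : \sum_(j < m') v j * orient (circ a) (circ b) ((circ \o S) j) == 0.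
  by rewrite eq_le (sumr_ge0 _ (fun j _ => ge0 j)) andbT -(orient_hull _ _ v1 y1 y2).
rewrite psumr_eq0 // => /allP v0'.
move: v1; rewrite big1 => [/eqP|j _]; first by rewrite eq_sym oner_eq0.
have := v0' j (mem_index_enum j); rewrite mulf_eq0 (gt_eqF (gt0 j)) orbF.
by move/eqP.
Qed.

Lemma in_hull_segment m (P : 'I_m -> point) (i j : 'I_m) (u v : R) :
  0 <= u -> 0 <= v -> u + v = 1 ->
  in_hull P (u * (P i).1 + v * (P j).1, u * (P i).2 + v * (P j).2).
Proof.
move=> u0 v0 uv1.
have sumE (f : 'I_m -> R) :
    \sum_(k < m) ((k == i)%:R * u + (k == j)%:R * v) * f k = u * f i + v * f j.
  under eq_bigr do rewrite mulrDl -!mulrA.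
  rewrite big_split /=; congr (_ + _).
    by rewrite (bigD1 i) //= eqxx mul1r big1 ?addr0 // => k /negPf ->; rewrite mul0r.
  by rewrite (bigD1 j) //= eqxx mul1r big1 ?addr0 // => k /negPf ->; rewrite mul0r.
exists (fun k => (k == i)%:R * u + (k == j)%:R * v); split => //.
- by move=> k; rewrite addr_ge0 // mulr_ge0 ?ler0n.
- by under eq_bigr do rewrite -[_ + _]mulr1; rewrite (sumE (fun=> 1)) !mulr1.
Qed.

Lemma in_hull_vertex m (P : 'I_m -> point) (i : 'I_m) : in_hull P (P i).
Proof.
have := in_hull_segment P i i ler01 (lexx 0) (addr0 1).
by rewrite !mul1r !mul0r !addr0 -surjective_pairing.
Qed.

(** Chords with alternating ends cross; the common point comes from the affine dependence of four
    plane points, with coefficients proportional to areas of the triangles they span. *)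
Lemma hull_crossing m m' (T : 'I_m -> R) (S : 'I_m' -> R) i1 i2 j1 j2 :
  T i1 < S j1 -> S j1 < T i2 -> T i2 < S j2 ->
  exists x, in_hull (circ \o T) x /\ in_hull (circ \o S) x.
Proof.
move=> l1 l2 l3.
pose A := circ (T i1); pose B := circ (S j1); pose C := circ (T i2); pose D := circ (S j2).
have a0 : 0 < orient B C D by exact: orient_circ_gt0.
have b0 : 0 < orient A C D by apply: orient_circ_gt0 => //; exact: lt_trans l2.
have c0 : 0 < orient A B D by apply: orient_circ_gt0 => //; exact: lt_trans l3.
have d0 : 0 < orient A B C by exact: orient_circ_gt0.
pose s := orient B C D + orient A B D.
have s0 : s != 0 by rewrite gt_eqF // addr_gt0.
have sE : s = orient A C D + orient A B C by rewrite /s /orient; ring.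
have div_ge0 r : 0 < r -> 0 <= r / s by move=> r0; rewrite divr_ge0 // ltW // addr_gt0.
exists (orient B C D / s * A.1 + orient A B D / s * C.1,
        orient B C D / s * A.2 + orient A B D / s * C.2); split.
  apply: (in_hull_segment (circ \o T)); rewrite ?div_ge0 //.
  by rewrite -mulrDl -/s divff.
rewrite (_ : (_, _) = (orient A C D / s * B.1 + orient A B C / s * D.1,
        orient A C D / s * B.2 + orient A B C / s * D.2)); last first.
  by congr pair; rewrite -!(mulrAC _ _ s^-1) -!mulrDl; congr (_ / s); rewrite /orient; ring.
apply: (in_hull_segment (circ \o S)); rewrite ?div_ge0 //.
by rewrite -mulrDl -sE divff.
Qed.

Definition rot (a b : R) (x : point) : point :=
  (a * x.1 + b * x.2, a * x.2 - b * x.1).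

Lemma in_hull_rot m (P : 'I_m -> point) a b x :
  in_hull P x -> in_hull (rot a b \o P) (rot a b x).
Proof.
case=> c [c0 c1 x1 x2]; exists c; split => //=; rewrite x1 x2 !mulr_sumr.
  by rewrite -big_split; apply: eq_bigr => i _ /=; ring.
by rewrite -sumrB; apply: eq_bigr => i _ /=; ring.
Qed.

Lemma rotK a b : a ^+ 2 + b ^+ 2 = 1 -> cancel (rot a b) (rot a (- b)).
Proof.
move=> ab [x y]; rewrite /rot /=; congr pair.
  by rewrite -[RHS]mul1r -ab; ring.
by rewrite -[RHS]mul1r -ab; ring.
Qed.

Lemma on_circle_rot a b x : a ^+ 2 + b ^+ 2 = 1 -> on_circle x -> on_circle (rot a b x).
Proof.
rewrite /on_circle /rot /= => ab x1.
by rewrite -[RHS]mul1r -{1}ab -x1; ring.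
Qed.

Lemma in_hull_ext m (P Q : 'I_m -> point) x : P =1 Q -> in_hull P x -> in_hull Q x.
Proof.
move=> PQ [c [c0 c1 x1 x2]]; exists c; split => //.
  by rewrite x1; apply: eq_bigr => i _; rewrite PQ.
by rewrite x2; apply: eq_bigr => i _; rewrite PQ.
Qed.

(** Stereographic projection: the parameter is the slope of the line from [(-1, 0)] to [x]. *)
Lemma circ_surj (x : point) : on_circle x -> x != (-1, 0) -> x = circ (x.2 / (1 + x.1)).
Proof.
case: x => [x y] /=; rewrite /on_circle /circ /= => xy xN.
have x1 : 1 + x != 0.
  apply: contraNneq xN => x1; have {}x1 : x = -1 by apply/eqP; rewrite -addr_eq0 addrC x1.
  have /eqP : y ^+ 2 = 0 by move: xy; rewrite x1 sqrrN expr1n; lra.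
  by rewrite sqrf_eq0 x1 => /eqP->.
have y2 : y ^+ 2 = (1 + x) * (1 - x) by rewrite -[1 + x]opprK; lra.
have d : 1 + (y / (1 + x)) ^+ 2 = 2 / (1 + x).
  by rewrite exprMn y2; field.
have d' : 1 - (y / (1 + x)) ^+ 2 = 2 * x / (1 + x).
  by rewrite exprMn y2; field.
by rewrite d d'; congr pair; field; rewrite x1.
Qed.

Definition meets (k l : nat) (T : 'I_k -> R) (S : 'I_l -> R) : Prop :=
  exists x, in_hull (circ \o T) x /\ in_hull (circ \o S) x.

(** Pigeonhole: [circ] is injective on the parameters [0, ..., #|I|]. *)
Lemma exists_circ_avoiding (I : finType) (P : I -> point) :
  exists t, forall i, P i != circ t.
Proof.
have [t /forallP tP|allP] :=
  pickP (fun t : 'I_#|I|.+1 => [forall i, P i != circ t%:R]); first by exists t%:R.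
have hit (t : 'I_#|I|.+1) : exists i, P i == circ t%:R.
  by have /negbT := allP t; rewrite negb_forall => /existsP[i /negPn]; exists i.
pose g t := xchoose (hit t).
have g_inj : injective g.
  move=> s t gst; have /eqP e1 := xchooseP (hit s); have /eqP e2 := xchooseP (hit t).
  move: e1; rewrite -/(g s) gst e2 => /circ_inj /eqP.
  by rewrite eqr_nat => /eqP /val_inj ->.
by have := leq_card g g_inj; rewrite card_ord ltnn.
Qed.

(* A rotation moves an unused point of the circle to (-1, 0), the only one not of the form circ t. *)
Lemma polygon_params k n (F : 'I_n -> 'I_k -> point) :
  (forall v, inscribed_polygon (F v)) ->
  exists2 T : 'I_n -> 'I_k -> R, forall v, injective (T v) &
    forall u v, (exists x, in_hull (F u) x /\ in_hull (F v) x) <-> meets (T u) (T v).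
Proof.
move=> FP; have [t Ft] := exists_circ_avoiding (fun vi : 'I_n * 'I_k => F vi.1 vi.2).
have := on_circle_circ t; case: (circ t) Ft => c1 c2 Ft c_circ.
pose a := - c1; pose b := - c2.
have ab : a ^+ 2 + b ^+ 2 = 1 by rewrite !sqrrN.
have ab' : a ^+ 2 + (- b) ^+ 2 = 1 by rewrite !sqrrN.
have rotKV : cancel (rot a (- b)) (rot a b) by move=> x; rewrite -{1}[b]opprK rotK.
pose T v i := (rot a b (F v i)).2 / (1 + (rot a b (F v i)).1).
have TE v i : rot a b (F v i) = circ (T v i).
  apply: circ_surj; first by apply: on_circle_rot => //; case: (FP v).
  apply: contra (Ft (v, i)) => /eqP /= Fvi.
  rewrite -[F v i](rotK ab) Fvi /rot /= /a /b; apply/eqP; congr pair; ring.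
exists T => [v i j Tij|u v].
  have [Fv_inj _] := FP v; apply/Fv_inj/(can_inj (rotK ab)).
  by rewrite !TE Tij.
split=> -[x [xu xv]].
  by exists (rot a b x); split; [apply: in_hull_ext (in_hull_rot a b xu)|
    apply: in_hull_ext (in_hull_rot a b xv)] => i /=; rewrite TE.
by exists (rot a (- b) x); split; [apply: in_hull_ext (in_hull_rot a (- b) xu)|
  apply: in_hull_ext (in_hull_rot a (- b) xv)] => i /=; rewrite -TE rotK.
Qed.

Lemma meets_sym k l (T : 'I_k -> R) (S : 'I_l -> R) : meets T S -> meets S T.
Proof. by case=> x [xT xS]; exists x. Qed.

Lemma disjoint_neq k l (T : 'I_k -> R) (S : 'I_l -> R) i j : ~ meets T S -> T i != S j.
Proof.
move=> TS; apply/eqP => Tij; apply: TS; exists (circ (T i)); split.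
  exact: (in_hull_vertex (circ \o T)).
by rewrite Tij; exact: (in_hull_vertex (circ \o S)).
Qed.

(** A vertex of [S] outside the interval would span with [S j0] a chord crossing the one from [T i]
    to [T i']. *)
Lemma disjoint_between k l (T : 'I_k -> R) (S : 'I_l -> R) i i' j0 :
  ~ meets T S -> T i < S j0 < T i' -> forall j, T i < S j < T i'.
Proof.
move=> TS /andP[l1 l2] j; apply/negPn/negP; rewrite negb_and -!leNgt => /orP[]; rewrite le_eqVlt.
  rewrite eq_sym (negPf (disjoint_neq i j TS)) /= => l0; apply/TS/meets_sym.
  exact: hull_crossing l0 l1 l2.
rewrite (negPf (disjoint_neq i' j TS)) /= => l3; apply: TS.
exact: hull_crossing l1 l2 l3.
Qed.

(** With no vertex of [S'] in the interval, the chord from [T i] to [T i'] would separate [S] from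
    [S']; one vertex inside brings in the others. *)
Lemma disjoint_between_meets k l l' (T : 'I_k -> R) (S : 'I_l -> R) (S' : 'I_l' -> R) i i' :
  ~ meets T S' -> meets S S' -> T i < T i' ->
  (forall j, T i < S j < T i') -> forall j, T i < S' j < T i'.
Proof.
move=> TS' [x [xS xS']] lii' Sin.
have [/existsP[j0 j0in]|] := boolP [exists j, T i < S' j < T i'].
  exact: disjoint_between j0in.
rewrite negb_exists => /forallP S'out; exfalso.
apply: (hull_separated lii' _ _ xS xS') => j.
  by have /andP[l1 l2] := Sin j; rewrite !ltW.
have := S'out j; rewrite negb_and -!leNgt !le_eqVlt eq_sym.
by rewrite (negPf (disjoint_neq i j TS')) (negPf (disjoint_neq i' j TS')).
Qed.

(** * Long wheels are not polygon-circle graphs *)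

Section Wheel.
Variables (k L : nat) (W : 'I_k -> R) (rim : nat -> 'I_k -> R).
Hypotheses (k2 : (2 <= k)%N) (L_ge : (2 * k + 4 <= L)%N).
Hypothesis rim_inj : forall p, injective (rim p).
Hypothesis rim_period : forall p, rim (p + L)%N = rim p.
Hypothesis rim_meets : forall p, meets (rim p) (rim p.+1).
Hypothesis rim_disjoint : forall p d, (2 <= d)%N -> (d + 2 <= L)%N ->
  ~ meets (rim p) (rim (p + d)%N).
Hypothesis hub_meets : forall p, meets W (rim p).

(** Since [L >= 2 * k + 4], these polygons are pairwise disjoint; without one of them there still
    remain [k + 1], more than the hub has vertices. *)
Let b (i : 'I_k.+2) := rim (2 * i)%N.

Let between (i : 'I_k.+2) (p p' : 'I_k) (S : 'I_k -> R) :=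
  [forall j, b i p < S j < b i p'].

Let nested (i i' : 'I_k.+2) :=
  [exists p, exists p', (b i p < b i p') && between i p p' (b i')].

Let offset (i i' : 'I_k.+2) : i != i' ->
  exists d, [/\ (2 <= d)%N, (d + 2 <= L)%N & b i' = rim (2 * i + d)%N].
Proof.
move=> ii'; have := ltn_ord i; have := ltn_ord i'.
have [lt_ii'|lt_i'i|/val_inj e_ii'] := ltngtP i i'; last by rewrite e_ii' eqxx in ii'.
  move=> lti' lti; exists (2 * (i' - i))%N; split; try lia.
  by congr rim; lia.
move=> lti' lti; exists (L - 2 * (i - i'))%N; split; try lia.
by rewrite /b -rim_period; congr rim; lia.
Qed.

Let b_disjoint i i' : i != i' -> ~ meets (b i) (b i').
Proof. by case/offset => d [d2 dL ->]; exact: rim_disjoint. Qed.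

(** Without [b i] and its two neighbours the rim is a path of polygons disjoint from [b i], and
    lying in the interval propagates along it. *)
Let between_all i i1 p p' : i1 != i -> b i p < b i p' -> between i p p' (b i1) ->
  forall i2, i2 != i -> between i p p' (b i2).
Proof.
move=> i1i lpp' in1 i2 i2i.
have /offset[d1 [d1_ge d1_le b1]] : i != i1 by rewrite eq_sym.
have /offset[d2 [d2_ge d2_le b2]] : i != i2 by rewrite eq_sym.
rewrite b1 in in1; rewrite b2.
have step d : (2 <= d)%N -> (d + 3 <= L)%N ->
    between i p p' (rim (2 * i + d)%N) = between i p p' (rim (2 * i + d.+1)%N).
  move=> d_ge d_le; have meet := rim_meets (2 * i + d)%N; rewrite -addnS in meet.
  apply/forallP/forallP; apply: disjoint_between_meets => //.
  - by apply: rim_disjoint; lia.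
  - by apply: rim_disjoint; lia.
  - exact: meets_sym.
have from2 d : (2 <= d)%N -> (d + 2 <= L)%N ->
    between i p p' (rim (2 * i + 2)%N) = between i p p' (rim (2 * i + d)%N).
  elim: d => // d IHd d_ge d_le; have [d_gt|d_lt] := ltnP 2 d.+1; last first.
    by congr (between _ _ _ (rim (2 * i + _)%N)); lia.
  by rewrite IHd; [apply: step; lia | lia | lia].
by rewrite -from2 // (from2 d1).
Qed.

Let surrounding i := [exists i', (i' != i) && nested i i'].

(** By [between_all] two such polygons would enclose each other, so [b i p] and [b i' r] would each
    be the smaller. *)
Let surrounding_uniq i i' : surrounding i -> surrounding i' -> i = i'.
Proof.
move=> /existsP[i1 /andP[i1i /existsP[p /existsP[p' /andP[lp in1]]]]].
move=> /existsP[i2 /andP[i2i /existsP[r /existsP[r' /andP[lr in2]]]]].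
apply/eqP/negPn/negP => ii'; rewrite eq_sym in ii'.
have /forallP/(_ r)/andP[pr _] := between_all i1i lp in1 ii'.
rewrite eq_sym in ii'.
have /forallP/(_ p)/andP[rp _] := between_all i2i lr in2 ii'.
by have := lt_trans pr rp; rewrite ltxx.
Qed.

Let hit i j := [exists p, exists p', b i p <= W j <= b i p'].

(** Otherwise the chord between the extreme vertices of [b i], distinct as [k >= 2], would separate
    [b i] from the hub. *)
Let exists_hit i : exists j, hit i j.
Proof.
have [/existsP //|nohit] := boolP [exists j, hit i j]; exfalso.
pose o : 'I_k := Ordinal (ltnW k2).
pose pmin := [arg min_(p < o) b i p]%O; pose pmax := [arg max_(p > o) b i p]%O.
have minP p : b i pmin <= b i p by rewrite /pmin; case: arg_minP => // q _; exact.
have maxP p : b i p <= b i pmax by rewrite /pmax; case: arg_maxP => // q _; exact.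
have lt_mm : b i pmin < b i pmax.
  rewrite lt_neqAle minP andbT; apply/eqP => e_mm.
  have all_min p : b i p = b i pmin by apply: le_anti; rewrite minP e_mm maxP.
  by have /rim_inj : b i o = b i (Ordinal k2) by rewrite all_min [RHS]all_min.
have [x [xW xb]] := hub_meets (2 * i)%N.
apply: (hull_separated lt_mm _ _ xb xW) => j; first by rewrite minP maxP.
rewrite !ltNge -negb_and; apply: contra nohit => mm.
by apply/existsP; exists j; apply/existsP; exists pmin; apply/existsP; exists pmax.
Qed.

(** Of the two left ends [p] and [r] of intervals around the shared hub vertex, the larger lies in
    the other interval, so by [disjoint_between] one polygon surrounds the other. *)
Let hit_inj i i' j : ~~ surrounding i -> ~~ surrounding i' -> hit i j -> hit i' j -> i = i'.
Proof.
move=> si si' /existsP[p /existsP[p' /andP[px xp']]] /existsP[r /existsP[r' /andP[rx xr']]].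
apply/eqP/negPn/negP => ii'; have dis := b_disjoint ii'.
have [lpr|lrp|epr] := ltgtP (b i p) (b i' r); last first.
- by have := disjoint_neq p r dis; rewrite epr eqxx.
- have lpr' : b i p < b i' r'.
    by rewrite lt_neqAle (disjoint_neq p r' dis) (le_trans px).
  case/negP: si'; apply/existsP; exists i; rewrite ii'.
  apply/existsP; exists r; apply/existsP; exists r'; rewrite (lt_trans lrp) //=.
  apply/forallP; apply: (@disjoint_between _ _ _ _ _ _ p); last by rewrite lrp.
  by move/meets_sym.
- have lrp' : b i' r < b i p'.
    by rewrite lt_neqAle eq_sym (disjoint_neq p' r dis) (le_trans rx).
  case/negP: si; apply/existsP; exists i'; rewrite eq_sym ii'.
  apply/existsP; exists p; apply/existsP; exists p'; rewrite (lt_trans lpr) //=.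
  by apply/forallP; apply: (@disjoint_between _ _ _ _ _ _ r); rewrite ?lpr.
Qed.

(* Every second rim polygon has a vertex of the hub in its parameter interval; these intervals are
   disjoint, except that at most one of the polygons may surround the others. *)
Lemma long_wheel_not_polygon_circle : False.
Proof.
pose A := [set i | ~~ surrounding i].
pose g i := xchoose (exists_hit i).
have gP i : hit i (g i) := xchooseP (exists_hit i).
have g_inj : {in A &, injective g}.
  move=> i i'; rewrite !inE => si si' gii'; apply: hit_inj si si' (gP i) _.
  by rewrite gii'.
have leAk : (#|A| <= k)%N.
  by rewrite -(card_in_imset g_inj) -[X in (_ <= X)%N]card_ord max_card.
have leA1 : (#|~: A| <= 1)%N.
  by apply/card_le1_eqP => i i'; rewrite !inE !negbK => si si'; exact: surrounding_uniq.
by have := cardsC A; rewrite card_ord; lia.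
Qed.

End Wheel.

Local Close Scope ring_scope.

(** * Fans are circle graphs *)

Section Fan.
Local Open Scope nat_scope.
Variables (k n : nat) (e : rel 'I_n) (w : 'I_n) (pos : 'I_n -> nat).
Hypotheses (k2 : 2 <= k) (esym : symmetric e).
Hypothesis pos_inj : forall x y, x != w -> y != w -> pos x = pos y -> x = y.
Hypothesis ew : forall x, x != w -> e w x.
Hypothesis epos : forall x y, x != w -> y != w -> pos x < pos y ->
  e x y = (pos y == (pos x).+1).

(* The polygon at position p is close to a chord from - bot p to top p, and the hub to a chord from 0 to
   a point beyond all the others. Two such chords cross when top and bot order them oppositely; the
   shifts by 3 produce this exactly for consecutive positions. *)
Let top p := k * (if odd p then p.*2 + 3 else p.*2).
Let bot p := k * (if odd p then p.*2 else p.*2 + 3).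
Let bound := k * ((\max_x pos x).*2 + 5).

(** Vertex [0] is one end of the near-chord; the other vertices crowd at the other end, in a gap
    that the factor [k] keeps free. *)
Let param (v : 'I_n) (j : 'I_k) : int :=
  if v == w then (if j == 0 :> nat then 0%R else Posz (bound + j))
  else if j == 0 :> nat then (- Posz (bot (pos v)))%R else Posz (top (pos v) + j).
Let poly v j : point := circ (param v j)%:~R%R.

Let i0 : 'I_k := Ordinal (ltnW k2).
Let i1 : 'I_k := Ordinal k2.

Let poly_cross u v : (param u i0 < param v i0 < param u i1)%R ->
  (param u i1 < param v i1)%R -> exists x, in_hull (poly u) x /\ in_hull (poly v) x.
Proof.
move=> /andP[l1 l2] l3.
by apply: (@hull_crossing _ _ (fun j => (param u j)%:~R%R)
  (fun j => (param v j)%:~R%R) i0 i1 i0 i1); rewrite ltr_int.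
Qed.

Let poly_disjoint u v (a b : int) x : (a < b)%R ->
  (forall j, (a <= param u j <= b)%R) ->
  (forall j, (param v j < a)%R || (b < param v j)%R) ->
  in_hull (poly u) x -> in_hull (poly v) x -> False.
Proof.
move=> ab ua vb.
apply: (@hull_separated _ _ (fun j => (param u j)%:~R%R)
  (fun j => (param v j)%:~R%R) a%:~R%R b%:~R%R); first by rewrite ltr_int.
- by move=> j; rewrite !ler_int.
- by move=> j; rewrite !ltr_int.
Qed.

Let paramE v j : v != w -> param v j =
  if j == 0 :> nat then (- Posz (bot (pos v)))%R else Posz (top (pos v) + j).
Proof. by rewrite /param => /negPf ->. Qed.

Let hub_meets v : v != w -> exists x, in_hull (poly w) x /\ in_hull (poly v) x.
Proof.
move=> vw.
have [x [xv xw]] : exists x, in_hull (poly v) x /\ in_hull (poly w) x.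
  have le_pos : pos v <= \max_x pos x by exact: leq_bigmax.
  have le_top : top (pos v) < bound by rewrite ltn_mul2l; case: ifP; lia.
  apply: poly_cross; rewrite !(paramE _ vw) /param eqxx /=; last by lia.
  have : 0 < bot (pos v) by rewrite muln_gt0; case: ifP; case: (pos v) => *; lia.
  by lia.
by exists x.
Qed.

Let path_meets u v : u != w -> v != w -> pos u < pos v ->
  (pos v == (pos u).+1) <-> exists x, in_hull (poly u) x /\ in_hull (poly v) x.
Proof.
move=> uw vw luv; have k0 : 0 < k by exact: ltnW.
split=> [/eqP pv|[x [xu xv]]].
  have [pu|pu] := boolP (odd (pos u)).
    have [x [xv xu]] : exists x, in_hull (poly v) x /\ in_hull (poly u) x; last by exists x.
    have l1 : bot (pos u) < bot (pos v).
      by rewrite /bot pv /= pu /= ltn_mul2l; lia.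
    have l2 : top (pos v) < top (pos u).
      by rewrite /top pv /= pu /= ltn_mul2l; lia.
    by apply: poly_cross; rewrite !paramE //=; lia.
  have l1 : bot (pos v) < bot (pos u).
    by rewrite /bot pv /= pu (negPf pu) /= ltn_mul2l; lia.
  have l2 : top (pos u) < top (pos v).
    by rewrite /top pv /= pu (negPf pu) /= ltn_mul2l; lia.
  by apply: poly_cross; rewrite !paramE //=; lia.
(* From distance two on, the parameter intervals are nested and the chord from [- bot (pos u)] to
   [top (pos u) + k] separates. *)
apply/negPn/negP => pv; have {pv}luv : (pos u).+1 < pos v by lia.
have l1 : bot (pos u) < bot (pos v).
  by rewrite ltn_mul2l k0; do 2![case: ifP] => *; lia.
have l2 : top (pos u) + k <= top (pos v).
  by rewrite -mulnSr leq_mul2l; do 2![case: ifP] => *; lia.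
apply: (@poly_disjoint u v (- Posz (bot (pos u)))%R (Posz (top (pos u) + k)) x) => //.
- by lia.
- by move=> j; rewrite paramE //; have := ltn_ord j; case: ifP; lia.
- by move=> j; rewrite paramE //; have := ltn_ord j; case: ifP; lia.
Qed.

Lemma fan_polygon_circle_graph : polygon_circle_graph k e.
Proof.
exists poly; split=> [v|u v uv].
  split=> [i j /circ_inj /intr_inj|i]; last exact: on_circle_circ.
  rewrite /param => eq_ij; apply/val_inj => /=.
  by move: eq_ij; do !case: ifP; lia.
have [uw|uw] := eqVneq u w.
  have vw : v != w by rewrite -uw eq_sym.
  by rewrite uw ew //; split=> // _; exact: hub_meets.
have [vw|vw] := eqVneq v w.
  rewrite vw esym ew //; split=> // _.
  by have [x [xu xv]] := hub_meets uw; exists x.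
have [luv|lvu|/pos_inj e_uv] := ltngtP (pos u) (pos v).
- by rewrite epos //; exact: path_meets.
- rewrite esym epos //; have [meet meet'] := path_meets vw uw lvu.
  split=> [/meet|] [x [xu xv]]; first by exists x.
  by apply: meet'; exists x.
- by rewrite e_uv ?eqxx in uv.
Qed.

End Fan.

(** * Fans and wheels encoded by permutations *)

Lemma muln_add_inj q u v b c : b < q -> c < q -> q * u + b = q * v + c -> u = v /\ b = c.
Proof.
move=> bq cq e.
have := f_equal (divn^~ q) e; have := f_equal (modn^~ q) e.
have q0 : 0 < q by exact: leq_ltn_trans bq.
by rewrite !(mulnC q) !modnMDl !divnMDl // !modn_small // !divn_small // !addn0.
Qed.

Section CrossedFan.
Variables (m' q' r : nat).
Local Notation m := m'.+1.
Local Notation q := q'.+2.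

Definition vertex := option ('I_m * 'I_q + 'I_r)%type.

Definition seg (i : 'I_m) (a : 'I_q) : vertex := Some (inl (i, a)).

(* The successor of a vertex when the end of segment i is joined to the beginning of segment t i. *)
Definition step (t : 'S_m) (x : vertex) : vertex :=
  if x is Some (inl (i, a)) then
    if a == ord_max then seg (t i) ord0 else seg i (inord a.+1)
  else x.

(** The second condition removes the edge entering the beginning of segment [0], cutting open the
    cycle of [t] through [0]. *)
Definition link (t : 'S_m) (x y : vertex) := (y == step t x) && (y != seg ord0 ord0).

(* None is adjacent to everything; the vertices inr _ only pad the graph to the required size. *)
Definition adj (t : 'S_m) (x y : vertex) :=
  (x != y) && [|| x == None, y == None, link t x y | link t y x].

Lemma adj_irrefl t : irreflexive (adj t).
Proof. by move=> x; rewrite /adj eqxx. Qed.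

Lemma adj_sym t : symmetric (adj t).
Proof.
by move=> x y; rewrite /adj eq_sym orbCA; congr (_ && (_ || (_ || _))); rewrite orbC.
Qed.

Lemma seg_eq i a j b : (seg i a == seg j b) = (i == j) && (a == b).
Proof. by []. Qed.

Lemma inordS_val (a : 'I_q) : a != ord_max -> (inord a.+1 : 'I_q) = a.+1 :> nat.
Proof.
move=> a_max; rewrite inordK //; have := ltn_ord a.
by rewrite ltnS leq_eqVlt => /orP[/eqP ea|//]; case/eqP: a_max; exact: val_inj.
Qed.

Lemma step_inj t : injective (step t).
Proof.
have inord_neq0 (a : 'I_q) : a != ord_max -> (ord0 == inord a.+1 :> 'I_q) = false.
  by move=> /inordS_val ea; apply/eqP => /(congr1 val) /=; rewrite ea.
move=> [[[i a]|l]|] [[[j b]|l']|] //=; try by case: ifP.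
case: ifPn => [/eqP->|a_max]; case: ifPn => [/eqP->|b_max].
- by case=> /perm_inj ->.
- by move/eqP; rewrite seg_eq inord_neq0 ?andbF.
- by move/eqP; rewrite seg_eq eq_sym [_ == ord0]eq_sym inord_neq0 ?andbF.
case=> -> /(congr1 val) /=; rewrite !inordS_val // => -[/val_inj ->] //.
Qed.

Section Position.
Variables (t : 'S_m) (rank : 'I_m -> nat).
Hypothesis rank_lt : forall i, rank i < m.
Hypothesis rank_inj : injective rank.
Hypothesis rankS : forall i j, (rank j == (rank i).+1) = (j == t i) && (j != ord0).

(** [rank] orders the segments along the long path; padding vertices get even numbers beyond it, so
    that they are consecutive to nothing. *)
Definition position (x : vertex) : nat :=
  match x with
  | None => 0
  | Some (inl (i, a)) => q * rank i + a
  | Some (inr l) => (q * m + l).*2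
  end.

Lemma position_seg_lt i a : position (seg i a) < q * m.
Proof.
apply: (@leq_trans (q * (rank i).+1)); last by rewrite leq_mul2l rank_lt orbT.
by rewrite mulnS [X in _ < X]addnC ltn_add2l.
Qed.

Lemma position_inj x y : x != None -> y != None -> position x = position y -> x = y.
Proof.
case: x y => [[[i a]|l]|] [[[j b]|l']|] // _ _ /=.
- by case/(muln_add_inj (ltn_ord a) (ltn_ord b)) => /rank_inj -> /val_inj ->.
- by have /= := position_seg_lt i a; lia.
- by have /= := position_seg_lt j b; lia.
- by move=> e; congr (Some (inr _)); apply/val_inj => /=; lia.
Qed.

(** The end of segment [i] is followed by position [q * (rank i).+1], the beginning of the segment
    of next rank; by [rankS] this is segment [t i], except at the cut. *)
Lemma link_position x y : x != None -> y != None -> x != y ->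
  link t x y = (position y == (position x).+1).
Proof.
case: x y => [[[i a]|l]|] [[[j b]|l']|] // _ _ nxy; rewrite /link.
- rewrite /= -/(seg j b); case: ifPn => [/eqP->|a_max].
    rewrite !seg_eq -addnS /= -mulnSr; apply/idP/eqP.
      move=> /andP[/andP[jt /eqP b0]]; rewrite b0 eqxx andbT => j0.
      have : rank j == (rank i).+1 by rewrite rankS jt.
      by move/eqP->; rewrite addn0.
    rewrite -[RHS]addn0 => /(muln_add_inj (ltn_ord b) (ltn0Sn _)) [/eqP].
    rewrite rankS => /andP[-> j0] b0.
    by have -> : b = ord0 by [exact: val_inj]; rewrite eqxx (negPf j0).
  have := inordS_val a_max; set a' : 'I_q := inord a.+1 => a'E.
  rewrite !seg_eq -addnS -a'E; apply/idP/eqP.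
    by move=> /andP[/andP[/eqP-> /eqP->] _].
  case/(muln_add_inj (ltn_ord b) (ltn_ord _)) => /rank_inj -> /val_inj ->.
  by rewrite !eqxx -[a' == _]val_eqE /= a'E andbF.
- by have := position_seg_lt i a; rewrite /=; case: ifP => _ /=; lia.
- have := position_seg_lt j b; rewrite /= => lt_b; lia.
- rewrite [step _ _]/= eq_sym (negPf nxy) /=; lia.
Qed.

End Position.

End CrossedFan.

Lemma iter_injective T (f : T -> T) n : injective f -> injective (iter n f).
Proof. by move=> f_inj; elim: n => [|n IHn] x y //= /f_inj /IHn. Qed.

(** Adjacency at [x] depends on [t i] at the end of segment [i], on [t^-1 i] at its beginning, and
    nowhere else on [t]; as [q >= 2], no vertex is both. *)
Lemma adj_local m' q' r (F : 'S_m'.+1 -> Prop) (t : 'S_m'.+1) (x : vertex m' q' r) :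
  (forall i, exists2 s, F s & s i = t i) ->
  exists2 s, F s & adj s x =1 adj t x.
Proof.
move=> agree; have [s0 Fs0 _] := agree ord0.
case: x => [[[i a]|l]|]; last 2 first.
- exists s0 => // y; rewrite /adj /link.
  by case: y => [[[j b]|l']|] //=; case: ifP.
- by exists s0.
have [a_max|a_max] := eqVneq a ord_max.
  have [s Fs si] := agree i; exists s => // y; rewrite /adj /link a_max /= eqxx si.
  by case: y => [[[j b]|l']|] //=; case: ifP => // _; rewrite !seg_eq !andbF.
pose j0 := (t^-1)%g i; have tj0 : t j0 = i by rewrite permKV.
have [s Fs sj0] := agree j0; exists s => // y.
rewrite /adj /link /= (negPf a_max); case: y => [[[j b]|l']|] //=.
case: ifP => // _; rewrite !seg_eq.
suff -> : (i == s j) = (i == t j) by [].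
by rewrite -{1}tj0 -sj0 -tj0 !(inj_eq perm_inj).
Qed.

Lemma neighbour_view_eq n (e e' : rel 'I_n) id cert v :
  e v =1 e' v -> neighbour_view e id cert v = neighbour_view e' id cert v.
Proof.
by move=> ee'; rewrite /neighbour_view (_ : enum (e v) = enum (e' v)) //; exact: eq_enum.
Qed.

Section CrossedFanGraph.
Variables (m' q' r n : nat) (phi : 'I_n -> vertex m' q' r) (psi : vertex m' q' r -> 'I_n).
Hypotheses (phiK : cancel phi psi) (psiK : cancel psi phi).
Local Notation m := m'.+1.
Local Notation q := q'.+2.

Definition crossed_fan (t : 'S_m) : rel 'I_n := fun u v => adj t (phi u) (phi v).

Lemma crossed_fan_sym t : symmetric (crossed_fan t).
Proof. by move=> u v; exact: adj_sym. Qed.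

Lemma crossed_fan_network c t : 1 <= c -> network c (crossed_fan t) (fun v => v.+1).
Proof.
move=> c1; split.
- by split=> [v|]; [exact: adj_irrefl | exact: crossed_fan_sym].
- pose w := psi None.
  have hub v : connect (crossed_fan t) v w.
    have [->|vw] := eqVneq v w; first exact: connect0.
    apply: connect1; rewrite /crossed_fan /adj psiK eqxx orbT andbT.
    by rewrite -(inj_eq (can_inj psiK)) phiK.
  move=> u v; apply: connect_trans (hub u) _.
  by rewrite (sym_connect_sym (crossed_fan_sym t)); exact: hub.
- by move=> u v [/val_inj].
- move=> v; rewrite /= (leq_trans (ltn_ord v)) // -{1}(expn1 n) leq_pexp2l //.
  exact: leq_ltn_trans (ltn_ord v).
Qed.

Lemma crossed_fan_polygon_circle k (t : 'S_m) (rank : 'I_m -> nat) : 2 <= k ->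
  (forall i, rank i < m) -> injective rank ->
  (forall i j, (rank j == (rank i).+1) = (j == t i) && (j != ord0)) ->
  polygon_circle_graph k (crossed_fan t).
Proof.
move=> k2 rank_lt rank_inj rankS.
have phi_hub u : (phi u != None) = (u != psi None).
  by rewrite -(inj_eq (can_inj psiK)) phiK.
apply: (@fan_polygon_circle_graph k n _ (psi None) (fun u => position rank (phi u))) => //.
- exact: crossed_fan_sym.
- move=> u v; rewrite -!phi_hub => u0 v0 /(position_inj rank_lt rank_inj u0 v0).
  exact: (can_inj phiK).
- by move=> u; rewrite -phi_hub /crossed_fan /adj psiK eq_sym => ->.
move=> u v; rewrite -!phi_hub => u0 v0 luv.
have nuv : phi u != phi v by apply: contraTneq luv => ->; rewrite ltnn.
rewrite /crossed_fan /adj nuv (negPf u0) (negPf v0) /=.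
rewrite !(link_position rank_lt rank_inj rankS) // 1?eq_sym //.
by lia.
Qed.

Section NotPolygonCircle.
Variables (t : 'S_m) (i0 : 'I_m).
Hypothesis orbit_avoids0 : ord0 \notin porbit t i0.

Let start : vertex m' q' r := seg r i0 ord0.
Let rim p := iter p (step t) start.
Let len := fingraph.order (step t) start.

(** The rim visits only segments indexed by the orbit of [i0], so it never meets the cut at [0]. *)
Let rim_seg p : exists2 i, i \in porbit t i0 & exists a, rim p = seg r i a.
Proof.
elim: p => [|p [i iO [a]]]; first by exists i0; [exact: porbit_id | exists ord0].
rewrite /rim iterS => -> /=; case: ifP => _.
  exists (t i); last by exists ord0.
  by rewrite -eq_porbit_mem -[in t i](expg1 t) porbit_perm eq_porbit_mem.
by exists i => //; exists (inord a.+1).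
Qed.

Let rim_neq_hub p : rim p != None.
Proof. by have [i _ [a ->]] := rim_seg p. Qed.

Let rim_neq_start0 p : rim p != seg r ord0 ord0.
Proof.
have [i iO [a ->]] := rim_seg p; rewrite seg_eq negb_and.
by apply/orP; left; apply: contraNneq orbit_avoids0 => <-.
Qed.

Let rim_eq p d d' : d < len -> d' < len -> rim (p + d) = rim (p + d') -> d = d'.
Proof.
move=> dlt d'lt; rewrite /rim !iterD => /(iter_injective (@step_inj _ _ _ t)).
by move/(congr1 (findex (step t) start)); rewrite !findex_iter.
Qed.

Let rim_period p : rim (p + len) = rim p.
Proof. by rewrite /rim iterD iter_order //; exact: step_inj. Qed.

(** The first [q] rim vertices run through segment [i0] without repetition. *)
Let len_ge : q <= len.
Proof.
have rim_first p : p < q -> rim p = seg r i0 (inord p).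
  elim: p => [|p IHp] pq; first by congr seg; apply/val_inj; rewrite /= inordK.
  rewrite /rim iterS -/(rim p) IHp ?(ltnW pq) //= -val_eqE /= inordK ?(ltnW pq) //.
  by rewrite ltn_eqF.
rewrite leqNgt; apply/negP => len_lt.
have := rim_period 0; rewrite add0n rim_first // rim_first // => /eqP.
rewrite seg_eq eqxx /= -val_eqE /= !inordK //.
by rewrite eqn0Ngt /len fingraph.order_gt0.
Qed.

Let rim_neq p d : 0 < d < len -> rim p != rim (p + d).
Proof.
move=> /andP[d0 dlt]; apply/eqP; rewrite -{1}[p]addn0 => /rim_eq e.
by have {}e := e (ltn_trans d0 dlt) dlt; rewrite -e in d0.
Qed.

Let rim_neqS p d : 1 < d < len -> rim (p + d) != rim p.+1.
Proof.
move=> /andP[d1 dlt]; apply/eqP; rewrite -(addn1 p) => /rim_eq e.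
by have {}e := e dlt (ltn_trans d1 dlt); rewrite e in d1.
Qed.

Lemma crossed_fan_not_polygon_circle k : 2 <= k -> 2 * k + 4 <= q ->
  ~ polygon_circle_graph k (crossed_fan t).
Proof.
move=> k2 kq [P [Ppoly Pint]]; have [T T_inj TP] := polygon_params Ppoly.
have edge x y : x != y -> adj t x y <-> meets (T (psi x)) (T (psi y)).
  move=> xy; rewrite -TP -Pint; last by rewrite (inj_eq (can_inj psiK)).
  by rewrite /crossed_fan !psiK.
apply: (@long_wheel_not_polygon_circle k len (T (psi None)) (fun p => T (psi (rim p)))) => //.
- exact: leq_trans len_ge.
- by move=> p; rewrite rim_period.
- move=> p; have neq : rim p != rim p.+1.
    by rewrite -(addn1 p); apply: rim_neq; exact: leq_trans len_ge.
  by apply/edge => //; rewrite /adj neq /link eqxx rim_neq_start0 !orbT.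
(* A link would identify [rim (p + d)] with [rim p.+1], or [rim (p + d).+1] with [rim p]. *)
- move=> p d d2 dL.
  have neq : rim p != rim (p + d) by apply: rim_neq; lia.
  rewrite -edge // /adj neq !(negPf (rim_neq_hub _)) /= /link.
  rewrite -[step t (rim p)]/(rim p.+1) -[step t (rim (p + d))]/(rim (p + d).+1).
  rewrite -(addnS p d) (negPf (@rim_neqS _ _ _)) ?(negPf (@rim_neq _ _ _)) //; lia.
- move=> p; have neq : None != rim p by rewrite eq_sym rim_neq_hub.
  by apply/edge; rewrite // /adj neq.
Qed.

End NotPolygonCircle.
End CrossedFanGraph.

(** * Counting certificates *)

Local Open Scope group_scope.

(** The sign depends only on the number of cycles, here one; this is the common sign that the
    determinant argument requires. *)
Lemma transitive_odd_perm m (t : 'S_m.+1) :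
  (forall i, i \in porbit t ord0) -> odd_perm t = ~~ odd m.+1 :> bool.
Proof.
move=> tr; rewrite /odd_perm card_ord.
suff -> : porbits t = [set porbit t ord0] by rewrite cards1 addbT.
apply/setP => X; rewrite inE; apply/imsetP/eqP => [[i _ ->]|->]; last by exists ord0.
by apply/eqP; rewrite eq_porbit_mem.
Qed.

Lemma iter_ordS m k : (iter k (@ordS m.+1) ord0 : nat) = k %% m.+1.
Proof.
elim: k => [|k IHk]; first by rewrite mod0n.
by rewrite iterS /= IHk -addn1 modnDml addn1.
Qed.

Lemma iter_ordS_ord m (i : 'I_m.+1) : iter i (@ordS m.+1) ord0 = i.
Proof. by apply/val_inj; rewrite /= iter_ordS modn_small. Qed.

Section CyclesFromOrders.
Variable m' : nat.
Local Notation m := m'.+1.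

Definition rotation : 'S_m := perm (can_inj (@ordSK m)).

(* The cyclic permutation running through 'I_m'.+1 in the order 0, lift 0 (s 0), lift 0 (s 1), ... *)
Definition cycle_of_order (s : 'S_m') : 'S_m := rotation ^ lift_perm ord0 ord0 s.

Definition rank_of_order (s : 'S_m') (i : 'I_m) : nat := (lift_perm ord0 ord0 s)^-1 i.

Lemma cycle_of_orderE s i : cycle_of_order s (lift_perm ord0 ord0 s i) =
  lift_perm ord0 ord0 s (ordS i).
Proof. by rewrite permJ [rotation i]permE. Qed.

(** Iterating the cycle from [0] lists the elements in the chosen order, so [s] can be read off. *)
Lemma cycle_of_order_inj : injective cycle_of_order.
Proof.
move=> s s' e; have iterE u k : lift_perm ord0 ord0 u (iter k (@ordS m) ord0) =
    iter k (cycle_of_order u) ord0.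
  elim: k => [|k IHk]; first by rewrite lift_perm_id.
  by rewrite !iterS -IHk cycle_of_orderE.
apply/permP => i; apply: (@lift_inj _ ord0); rewrite -!(lift_perm_lift ord0).
by rewrite -[lift ord0 i]iter_ordS_ord !iterE e.
Qed.

Lemma rank_of_order_lt s i : rank_of_order s i < m.
Proof. exact: ltn_ord. Qed.

Lemma rank_of_order_inj s : injective (rank_of_order s).
Proof. by move=> i j /val_inj /perm_inj. Qed.

(** [ordS] adds one except when wrapping around to rank [0], which only the element [0] has. *)
Lemma rank_of_orderS s i j : (rank_of_order s j == (rank_of_order s i).+1) =
  (j == cycle_of_order s i) && (j != ord0).
Proof.
rewrite /rank_of_order; set p := lift_perm ord0 ord0 s.
have -> : (j == cycle_of_order s i) = ((p^-1 j) == ordS (p^-1 i)).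
  by rewrite -{1}[i](permKV p) cycle_of_orderE -{1}[j](permKV p) (inj_eq perm_inj).
have -> : (j != ord0) = (p^-1 j != ord0).
  by rewrite -{1}[j](permKV p) -{1}[ord0](lift_perm_id ord0 ord0 s) (inj_eq perm_inj).
rewrite -!val_eqE /=; have := ltn_ord (p^-1 j); have := ltn_ord (p^-1 i).
move: (p^-1 i : nat) (p^-1 j : nat) => a b; rewrite leq_eqVlt => /predU1P[->|lt_a] lt_b.
  by rewrite modnn (ltn_eqF lt_b); case: eqP.
by rewrite modn_small //; case: eqP => // ->.
Qed.

End CyclesFromOrders.

Local Close Scope group_scope.

(** [#|A|] is at most [#|B|] times the largest fibre; squares avoid the exponent [m / 2] of
    Hadamard's bound. *)
Lemma card_le_fibres (A B : finType) (g : A -> B) N :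
  (forall b, #|[set a | g a == b]| ^ 2 <= N) -> #|A| ^ 2 <= #|B| ^ 2 * N.
Proof.
move=> fib.
case: (pickP B) => [b0 _|B0]; last first.
  case: (pickP A) => [a _|A0]; first by have := B0 (g a).
  by rewrite (eq_card0 A0).
pose b := [arg max_(b > b0) #|[set a | g a == b]|].
have maxb b' : #|[set a | g a == b']| <= #|[set a | g a == b]|.
  by rewrite /b; case: arg_maxnP => // b1 _; exact.
have leA : #|A| <= #|B| * #|[set a | g a == b]|.
  apply: (@leq_trans (\sum_(b' : B) #|[set a | g a == b]|)); last first.
    by rewrite sum_nat_const.
  rewrite -[X in X <= _]sum1_card (partition_big g predT) //=.
  by apply: leq_sum => b' _; rewrite sum1dep_card maxb.
apply: (@leq_trans ((#|B| * #|[set a | g a == b]|) ^ 2)); first by rewrite leq_exp2r.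
by rewrite expnMn leq_mul2l fib orbT.
Qed.

Lemma card_certificates s : #|{: s.-bseq bool}| <= 2 ^ s.+1.
Proof.
rewrite card_bseq card_bool; elim: s => [|s IHs]; first by rewrite big_ord1.
by rewrite big_ord_recr /= [2 ^ s.+2]expnS mul2n -addnn leq_add.
Qed.

Lemma fact_sqr_le_certificates c k V s n m' q' r :
  n = (m'.+1 * q'.+2 + r).+1 -> 1 <= c -> 2 <= k -> 2 * k + 4 <= q'.+2 ->
  is_PLS c (polygon_circle_graph k) V s ->
  m'`! ^ 2 <= ((2 ^ (s n).+1) ^ n) ^ 2 * m'.+1 ^ m'.+1.
Proof.
move=> nE c1 k2 kq [complete sound].
have card_vertex : #|{: vertex m' q' r}| = n.
  by rewrite card_option card_sum card_prod !card_ord nE.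
pose phi (i : 'I_n) : vertex m' q' r := enum_val (cast_ord (esym card_vertex) i).
pose psi (x : vertex m' q' r) : 'I_n := cast_ord card_vertex (enum_rank x).
have phiK : cancel phi psi by move=> i; rewrite /psi /phi enum_valK cast_ordKV.
have psiK : cancel psi phi by move=> x; rewrite /psi /phi cast_ordK enum_rankK.
pose e := crossed_fan phi; pose id (v : 'I_n) := v.+1.
have /fin_all_exists[cert certP] (o : 'S_m') : exists f : {ffun 'I_n -> (s n).-bseq bool},
    forall v, accepts V (e (cycle_of_order o)) id (fun v => f v) v.
  have [|cert [cert_size cert_acc]] := complete n (e (cycle_of_order o)) id
    (crossed_fan_network phiK psiK _ c1).
    apply: (crossed_fan_polygon_circle phiK psiK k2 (rank_of_order_lt o)).
      exact: rank_of_order_inj.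
    exact: rank_of_orderS.
  exists [ffun v => Bseq (cert_size v)] => v.
  rewrite /accepts /neighbour_view ffunE; under eq_map do rewrite ffunE.
  exact: cert_acc.
have card_cert : #|{ffun 'I_n -> (s n).-bseq bool}| <= (2 ^ (s n).+1) ^ n.
  rewrite card_ffun card_ord leq_exp2r; last by rewrite nE.
  exact: card_certificates.
rewrite -(card_Sn m'); apply: (leq_trans (card_le_fibres (g := cert) (N := m'.+1 ^ m'.+1) _)).
  move=> f.
  pose B i j := [exists o, (cert o == f) && (cycle_of_order o i == j)].
  have signB (t : 'S_m'.+1) : (forall i, B i (t i)) -> odd_perm t = ~~ odd m'.+1.
    move=> Bt; apply: transitive_odd_perm => i0.
    (* If the orbit of [i0] missed [0], the graph of [t] would be a no-instance, yet under [f] every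
       vertex has in it the same view as in the accepted graph of some cycle. *)
    rewrite porbit_sym; apply/negPn/negP => i0_avoids.
    have notP := crossed_fan_not_polygon_circle psiK i0_avoids k2 kq.
    have [v /negP[]] := sound n (e t) id (crossed_fan_network phiK psiK t c1) notP (fun v => f v).
    have [|u [o /eqP cert_o ->] adj_v] :=
        @adj_local m' q' r (fun u => exists2 o, cert o == f & u = cycle_of_order o) t (phi v).
      move=> i; have /existsP[o /andP[fo /eqP ti]] := Bt i.
      by exists (cycle_of_order o) => //; exists o.
    rewrite /accepts -(neighbour_view_eq (e := e (cycle_of_order o))) => [|w].
      by rewrite -cert_o; exact: certP.
    exact: adj_v.
  apply: leq_trans (card_same_sign_matchings signB); rewrite leq_exp2r //.
  rewrite -(card_imset _ (@cycle_of_order_inj m')); apply: subset_leq_card.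
  apply/subsetP => t /imsetP[o]; rewrite inE => fo ->.
  by rewrite inE; apply/forallP => i; apply/existsP; exists o; rewrite fo eqxx.
by rewrite leq_mul2r leq_exp2r // card_cert orbT.
Qed.

(** * From the counting inequality to the logarithmic bound *)

Lemma bin_le_exp2 n m : 'C(n, m) <= 2 ^ n.
Proof.
have [mn|nm] := leqP m n; last by rewrite bin_small.
rewrite -[2]/(1 + 1) expnDn (bigD1 (Ordinal (mn : m < n.+1))) //=.
by rewrite !exp1n !muln1 leq_addr.
Qed.

(** The falling factorial of [2m] with [m] factors, each at least [m], is [m!] times a binomial
    coefficient of size at most [4 ^ m]. *)
Lemma exp_self_le_fact m : m ^ m <= 4 ^ m * m`!.
Proof.
apply: (@leq_trans ('C(m.*2, m) * m`!)); last first.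
  by rewrite leq_mul2r -[4]/(2 ^ 2) -expnM mul2n bin_le_exp2 orbT.
rewrite bin_ffact ffact_prod -[X in _ ^ X]card_ord -prod_nat_const.
by apply: leq_prod => i _; have := ltn_ord i; lia.
Qed.

(** The factorial bound gives [m ^ (m - 2) <= 2 ^ (4 * m + 2 * (S * n))]; since [n <= 2 * q * m],
    the exponent is linear in [m], and an [m]-th root bounds [m]. *)
Lemma size_bound_of_fact_sqr m' q r n s : 0 < q -> 3 <= m' -> r < q ->
  n = (m'.+1 * q + r).+1 ->
  m'`! ^ 2 <= ((2 ^ s.+1) ^ n) ^ 2 * m'.+1 ^ m'.+1 ->
  n <= 2 ^ (18 * q * s.+1).
Proof.
move=> q0 m3 rq nE fact_le; set m := m'.+1 in nE fact_le *; set S := s.+1 in fact_le *.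
have n_le : n <= 2 * q * m by rewrite nE /m; nia.
have m0 : 0 < m by [].
have pow_le : m ^ (2 * m) <= 2 ^ (4 * m + 2 * (S * n)) * m ^ m.+2.
  apply: (@leq_trans ((4 ^ m * m`!) ^ 2)); first by rewrite mulnC expnM leq_exp2r // exp_self_le_fact.
  rewrite factS -/m !expnMn; apply: leq_trans (leq_mul (leqnn _) (leq_mul (leqnn _) fact_le)) _.
  have -> : (4 ^ m) ^ 2 = 2 ^ (4 * m) by rewrite -[4]/(2 ^ 2) -!expnM; congr (2 ^ _); lia.
  have -> : ((2 ^ S) ^ n) ^ 2 = 2 ^ (2 * (S * n)) by rewrite -!expnM; congr (2 ^ _); lia.
  rewrite expnD -[m ^ m.+2]/(m * (m * m ^ m)) -mulnn.
  by move: (2 ^ _) (2 ^ _) (m ^ m) => a b p; apply: eq_leq; ring.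
have {}pow_le : m ^ (m - 2) <= 2 ^ (4 * m + 2 * (S * n)).
  rewrite -(leq_pmul2r (m := m ^ m.+2)) ?expn_gt0 ?m0 // -expnD.
  by rewrite (_ : m - 2 + m.+2 = 2 * m) //; lia.
have m_le : m <= 2 ^ (8 + 8 * q * S).
  rewrite -(leq_exp2r _ _ m0) -expnM.
  (* [m <= (m - 2) * 2] because [m >= 4]. *)
  apply: (@leq_trans (m ^ ((m - 2) * 2))); first by rewrite leq_pexp2l //; lia.
  rewrite expnM; apply: (@leq_trans ((2 ^ (4 * m + 2 * (S * n))) ^ 2)).
    by rewrite leq_exp2r.
  rewrite -expnM leq_pexp2l //.
  have := leq_mul (leqnn (4 * S)) n_le; nia.
apply: leq_trans n_le _.
(* The exponents sum to at most [18 * q * S], as [q] and [S] are positive. *)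
apply: (@leq_trans (2 ^ (2 * q) * 2 ^ (8 + 8 * q * S))).
  by apply: leq_mul => //; rewrite ltnW // ltn_expl.
rewrite -expnD leq_pexp2l // /S; nia.
Qed.

Lemma polygon_circle_omega_log c k V s : 1 <= c -> 2 <= k ->
  is_PLS c (polygon_circle_graph k) V s -> omega_log s.
Proof.
move=> c1 k2 pls; pose q := (2 * k + 2).+2.
(* Beyond this threshold [trunc_log 2 n] exceeds [18 * q], which forces [s n > 0]; then
   [s n + 1 <= 2 * s n] turns [18] into [36]. It also leaves room for four segments. *)
exists (36 * q), (2 ^ (18 * q).+1); split=> // n n_ge.
have qn : 5 * q <= n by apply: leq_trans n_ge; apply: (leq_trans _ (ltnW (ltn_expl _ _))) => //; lia.
have n_le : n <= 2 ^ (18 * q * (s n).+1).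
  (* All vertices but the hub are divided into segments of length [q]; the remainder is padding. *)
  have nE : n = (n.-1 %/ q * q + n.-1 %% q).+1 by rewrite -divn_eq prednK //; lia.
  have m_ge : 4 <= n.-1 %/ q by rewrite leq_divRL //; lia.
  have mE : n.-1 %/ q = (n.-1 %/ q).-1.+1 by rewrite prednK //; lia.
  rewrite {1}mE in nE.
  apply: (size_bound_of_fact_sqr _ _ _ nE) => //; [by lia|by rewrite ltn_mod|].
  by apply: (fact_sqr_le_certificates nE c1 k2 _ pls); lia.
have := leq_trunc_log 2 n_le; rewrite trunc_expnK // => log_le.
have := leq_trunc_log 2 n_ge; rewrite trunc_expnK // => log_ge.
have s_gt0 : 0 < s n.
  by rewrite lt0n; apply: contraTneq (leq_trans log_ge log_le) => ->; rewrite muln1 ltnn.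
apply: leq_trans log_le _; rewrite (_ : 36 * q * s n = 18 * q * (s n + s n)); last by ring.
by apply: leq_mul => //; lia.
Qed.

Theorem theorem6 (c : nat) : 1 <= c ->
  (forall (V : verifier) (s : nat -> nat),
      is_PLS c circle_graph V s -> omega_log s) /\
  (forall k : nat, 3 <= k ->
     forall (V : verifier) (s : nat -> nat),
      is_PLS c (polygon_circle_graph k) V s -> omega_log s).
Proof.
move=> c1; split=> [V s|k k3 V s]; first exact: (@polygon_circle_omega_log c 2).
by apply: polygon_circle_omega_log => //; exact: ltnW.
Qed.
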